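(* There is an absolute constant $C_0>0$ such that, for all sufficiently large integers $d$, $$\log_2\log_2 L(d)\ \ge\ \frac{2}{5}\,d-C_0 .$$
   Context: For an integer $d\ge 1$, a standard-basis path in $\mathbb{Z}^d$ of length $n$ is a sequence $P_0,P_1,\ldots,P_n$ of points of $\mathbb{Z}^d$ such that $P_t-P_{t-1}\in\{e_1,\ldots,e_d\}$ for $1\le t\le n$, where $e_1,\ldots,e_d$ are the standard basis vectors. $L(d)\in\mathbb{N}\cup\{\infty\}$ denotes the supremum of the lengths $n$ of standard-basis paths in $\mathbb{Z}^d$ whose vertex set $\{P_0,\ldots,P_n\}$ contains no collinear triple (no three distinct vertices lying on a common line). Logarithms of $+\infty$ are interpreted as $+\infty$. *)

(* Defs.v *)
From HB Require Import structures.
From mathcomp Require Import all_boot all_order all_algebra.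
From mathcomp Require Import all_classical all_reals all_analysis.

Set Implicit Arguments.
Unset Strict Implicit.
Unset Printing Implicit Defensive.

Import Order.TTheory GRing.Theory Num.Theory.
Import numFieldNormedType.Exports.

Local Open Scope classical_set_scope.
Local Open Scope ring_scope.

(* Only the values P 0, ..., P n matter. *)
Definition standard_basis_path (d n : nat) (P : nat -> 'rV[int]_d) : Prop :=
  forall t : nat, (t < n)%N -> exists i : 'I_d, P t.+1 - P t = delta_mx 0 i.

Definition vertex_set (d n : nat) (P : nat -> 'rV[int]_d) : set 'rV[int]_d :=
  [set P t | t in [set t : nat | (t <= n)%N]].

Section CollinearTriples.
Variables (R : realType) (d : nat).

Definition line (a v : 'rV[R]_d) : set 'rV[R]_d :=
  [set a + s *: v | s in [set: R]].

Definition is_line (l : set 'rV[R]_d) : Prop :=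
  exists a v : 'rV[R]_d, v != 0 /\ l = line a v.

Definition lattice_point (p : 'rV[int]_d) : 'rV[R]_d := map_mx intr p.

Definition has_collinear_triple (V : set 'rV[int]_d) : Prop :=
  exists p q r : 'rV[int]_d,
    [/\ V p, V q & V r] /\ [/\ p != q, q != r & p != r] /\
    exists l : set 'rV[R]_d, is_line l /\
      [/\ l (lattice_point p), l (lattice_point q) & l (lattice_point r)].

(* The supremum L(d), with value +oo when the lengths are unbounded. *)
Definition max_length : \bar R :=
  ereal_sup [set n%:R%:E | n in [set n : nat |
    exists P : nat -> 'rV[int]_d,
      standard_basis_path n P /\ ~ has_collinear_triple (vertex_set n P)]].

End CollinearTriples.

(* lne sends +oo to +oo (and nonpositive arguments to -oo). *)
Definition log2e (R : realType) (x : \bar R) : \bar R :=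
  (lne x * ((ln 2)^-1)%:E)%E.

(* Main.v *)
Require Import Defs.
From mathcomp Require Import all_boot all_order all_algebra.
From mathcomp Require Import all_classical all_reals all_analysis.
From mathcomp Require Import zify ring lra.
Import Order.TTheory GRing.Theory Num.Theory.
Local Open Scope ring_scope.

(** Two more dimensions are enough to square the length, up to a constant:
    from a path P with B steps in dimension d and no collinear triple one gets
    such a path with N steps in dimension d + 2 as soon as 16 N <= B ^ 2
    ([noncollinear_path_square]).  Since the constant 16 can be absorbed (if
    B = 16 M, then N = 16 M ^ 2), starting from a path with 32 steps and
    iterating k times gives 16 * 2 ^ (2 ^ k) steps in dimension about 2 k; so
    log2 (log2 (L d)) >= d / 2 - O(1), which implies the bound with 2 / 5.

    The squaring step repeats the word of P over and over and sprinkles two new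
    letters into it.  Let t count the old letters written so far.  The first
    new letter is written at the end of every block of B old letters, so its
    number x of occurrences is the index of the block.  The second is written
    whenever needed to keep its number y of occurrences within 2 of the
    parabola t ^ 2 / (2 N), whose slope stays at most 1 up to t = N.

    Consider a collinear triple of the new path.  The coordinate x takes on it
    either one value or three distinct ones.  If x is constant, the triple lies
    in one copy of P: forgetting y it would be collinear in P, unless all three
    points have the same t, and then y could take only two values.  If the
    three values of x differ, then t is an affine function of x along the line
    and grows by about B from one block to the next, so both differences u, v
    of consecutive values of t are at least B / 2 ([block_gaps]); but the three
    points (t, y) lie on a line and within bounded distance of the parabola,
    which forces u v < 4 N ([parabola_gaps]).  Hence B ^ 2 / 4 < 4 N, a
    contradiction. *)

(** * Collinearity as a proportionality over the integers *)

(** The sum of the coordinates grows by one at each step, so on a common line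
    the displacements between vertices are proportional to the differences of
    their indices; see [noncollinear_uptoP].  The indices thus serve as
    barycentric weights, and the condition is purely integral. *)
Definition noncollinear_upto (d n : nat) (P : nat -> 'rV[int]_d) : Prop :=
  forall a b c : nat, (a < b < c)%N -> (c <= n)%N ->
    (c%:Z - a%:Z) *: (P b - P a) <> (b%:Z - a%:Z) *: (P c - P a).

Lemma standard_basis_path_sum (d n : nat) (P : nat -> 'rV[int]_d) :
  standard_basis_path n P -> forall t, (t <= n)%N ->
  \sum_i P t 0 i = \sum_i P 0%N 0 i + t%:Z.
Proof.
move=> stdP; elim=> [|t IHt] lttn; first by rewrite addr0.
have [i0 /(canRL (subrK _)) ->] := stdP t lttn.
rewrite -[t.+1 in RHS]add1n PoszD addrCA -IHt ?(ltnW lttn)//.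
under eq_bigr do rewrite !mxE eqxx /=.
rewrite big_split (bigD1 i0)//= eqxx big1 ?addr0// => i /negPf.
by rewrite eq_sym => ->.
Qed.

(** Along a line the sum of the coordinates is an affine parameter, possibly
    degenerate, which is why the proportion is written without division. *)
Lemma line_proportional (R : realType) (d : nat) (a v p q r : 'rV[R]_d) :
  line a v p -> line a v q -> line a v r ->
  let ht (w : 'rV[R]_d) := \sum_i w 0 i in
  (ht r - ht p) *: (q - p) = (ht q - ht p) *: (r - p).
Proof.
move=> [s1 _ <-] [s2 _ <-] [s3 _ <-] ht.
have htD s : ht (a + s *: v) = ht a + s * ht v.
  by rewrite /ht mulr_sumr -big_split; apply: eq_bigr => i _; rewrite !mxE.
rewrite !htD; apply/rowP=> i; rewrite !mxE; ring.
Qed.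

Lemma noncollinear_uptoP (R : realType) (d n : nat)
    (P : nat -> 'rV[int]_d) :
  standard_basis_path n P -> noncollinear_upto d n P ->
  ~ has_collinear_triple R (vertex_set n P).
Proof.
move=> stdP ncP [_ [_ [_ [[[a /= an <-] [b /= bn <-] [c /= cn <-]]]]]].
move=> [[ab bc ac] [l [[u [v [_ ->]]] [la lb lc]]]].
have prop x y z : (x < y < z)%N -> (z <= n)%N ->
    line u v (lattice_point R (P x)) -> line u v (lattice_point R (P y)) ->
    line u v (lattice_point R (P z)) -> False.
  move=> /andP[xy yz] zn lx ly lz.
  apply: (ncP x y z) => //; first by rewrite xy.
  have yn := leq_trans (ltnW yz) zn; have xn := leq_trans (ltnW xy) yn.
  have := line_proportional _ _ _ _ _ _ _ lx ly lz.
  have htE t : (t <= n)%N -> \sum_i lattice_point R (P t) 0 i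
      = (\sum_i P 0%N 0 i)%:~R + (t%:Z)%:~R.
    move=> tn; rewrite -rmorphD -(standard_basis_path_sum _ _ _ stdP)//.
    rewrite rmorph_sum.
    by apply: eq_bigr => i _; rewrite [LHS]mxE.
  rewrite /= !htE// => /rowP E.
  apply/rowP=> i; move: (E i); rewrite !mxE => {}E.
  apply: (@intr_inj R); rewrite !rmorphM !rmorphB /=.
  have cancelE (s s1 s2 : R) : s + s1 - (s + s2) = s1 - s2 by ring.
  by move: E; rewrite !cancelE.
have neq x y : P x != P y -> x != y by apply: contraNneq => ->.
have {}ab := neq _ _ ab; have {}bc := neq _ _ bc; have {}ac := neq _ _ ac.
case: (ltngtP a b) ab => // ab _; case: (ltngtP b c) bc => // bc _;
  case: (ltngtP a c) ac => // ac _; try lia.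
- by apply: (prop a b c); rewrite ?ab.
- by apply: (prop a c b); rewrite ?ac.
- by apply: (prop c a b); rewrite ?ac.
- by apply: (prop b a c); rewrite ?ab.
- by apply: (prop b c a); rewrite ?bc.
- by apply: (prop c b a); rewrite ?bc.
Qed.

(** * Three aligned points near a parabola, or in three blocks *)

(** With weights al - be, be summing to al, the second difference of t ^ 2 at
    t1, t2, t3 is exactly al * (t2 - t1) * (t3 - t2).  That of 2 N y vanishes,
    and the excess of t ^ 2 over 2 N y is less than 4 N at the outer points and
    nonnegative at the middle one. *)
Lemma parabola_gaps (N al be t1 t2 t3 y1 y2 y3 : int) : 0 < N ->
  0 < be -> be < al ->
  al * (t2 - t1) = be * (t3 - t1) -> al * (y2 - y1) = be * (y3 - y1) ->
  t1 ^+ 2 < 2 * N * (y1 + 2) -> 2 * N * y2 <= t2 ^+ 2 ->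
  t3 ^+ 2 < 2 * N * (y3 + 2) ->
  (t2 - t1) * (t3 - t2) < 4 * N.
Proof.
move=> N0 be0 beal tE yE h1 h2 h3.
have al0 : 0 < al by lia.
rewrite -(ltr_pM2l al0).
have g0 : 0 < al - be by lia.
have k1 : (al - be) * t1 ^+ 2 < (al - be) * (2 * N * (y1 + 2)).
  by rewrite ltr_pM2l.
have k2 : al * (2 * N * y2) <= al * t2 ^+ 2 by rewrite ler_pM2l.
have k3 : be * t3 ^+ 2 < be * (2 * N * (y3 + 2)) by rewrite ltr_pM2l.
have -> : al * ((t2 - t1) * (t3 - t2))
    = (al - be) * t1 ^+ 2 + be * t3 ^+ 2 - al * t2 ^+ 2.
  have -> : (al - be) * t1 ^+ 2 + be * t3 ^+ 2 - al * t2 ^+ 2 =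
      al * ((t2 - t1) * (t3 - t2))
      - (t3 + t1) * (al * (t2 - t1) - be * (t3 - t1)) by ring.
  by rewrite tE subrr mulr0 subr0.
have k4 : al * (2 * N * y2) = 2 * N * ((al - be) * y1 + be * y3).
  have -> : al * (2 * N * y2) = 2 * N * (al * (y2 - y1) + al * y1) by ring.
  by rewrite yE; ring.
move: k1 k2 k3; rewrite k4; lra.
Qed.

(** From t1 to t3 at least x3 - x1 - 1 full blocks are crossed, and
    x3 - x1 - 1 >= (x3 - x1) / 2 as x2 lies strictly in between; so t grows by
    at least B / 2 per unit of x, along the whole line. *)
Lemma block_gaps (B al be t1 t2 t3 x1 x2 x3 : int) : 0 <= B ->
  0 < be -> be < al -> x1 < x3 ->
  al * (t2 - t1) = be * (t3 - t1) -> al * (x2 - x1) = be * (x3 - x1) ->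
  t1 <= (x1 + 1) * B -> x3 * B <= t3 ->
  B <= 2 * (t2 - t1).
Proof.
move=> B0 be0 beal x13 tE xE h1 h3.
have al0 : 0 < al by lia.
have x12 : 0 < x2 - x1.
  by rewrite -(pmulr_rgt0 _ al0) xE mulr_gt0 // subr_gt0.
have x23 : x2 < x3.
  suff : 0 < al * (x3 - x2) by rewrite pmulr_rgt0// subr_gt0.
  have -> : al * (x3 - x2) =
      (al - be) * (x3 - x1) - (al * (x2 - x1) - be * (x3 - x1)) by ring.
  by rewrite xE subrr subr0 mulr_gt0 ?subr_gt0.
have h13 : (x3 - x1) * B <= 2 * (t3 - t1).
  have : 0 <= (x3 - x1 - 2) * B by rewrite mulr_ge0//; lia.
  lia.
rewrite -(ler_pM2l al0).
have -> : al * (2 * (t2 - t1)) = be * (2 * (t3 - t1)).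
  by rewrite mulrCA tE; ring.
apply: (@le_trans _ _ (be * ((x3 - x1) * B))); last by rewrite ler_pM2l.
rewrite mulrA -xE -mulrA ler_pM2l// ler_peMl//; lia.
Qed.

(** * The path of squared length *)

(** The new word is produced letter by letter by an automaton, which gives its
    vertices indexed by their position without cutting a concatenation of
    blocks of unequal lengths.  Its state (t, x, y) counts the old letters, the
    letters closing a block and the letters climbing along the parabola. *)
Record clock := Clock { ticks : nat; blocks : nat; climb : nat }.

Definition clock_step (B N : nat) (s : clock) : clock :=
  let: Clock t x y := s in
  if (x.+1 * B <= t)%N then Clock t x.+1 y
  else if (2 * N * y.+1 <= t ^ 2)%N then Clock t x y.+1
  else Clock t.+1 x y.

Definition clock_at (B N n : nat) : clock :=
  iter n (clock_step B N) (Clock 0 0 0).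

(** A full block may or may not have been closed already, whence the overlap of
    the bounds on [t]; and [y] lags behind the parabola by less than 2, because
    an old letter, written only when the lag is less than 1, raises
    t ^ 2 / (2 N) by less than 1 while t < N. *)
Lemma clock_at_spec (B N n : nat) : (0 < N)%N -> (n <= N)%N ->
  let: Clock t x y := clock_at B N n in
  [/\ (t + x + y = n)%N, (x * B <= t <= x.+1 * B)%N
    & (2 * N * y <= t ^ 2 < 2 * N * y.+2)%N].
Proof.
move=> N0; elim: n => [|n IHn] nN.
  by split=> //=; rewrite ?muln0 ?muln_gt0 ?N0; lia.
move: (IHn (ltnW nN)); rewrite /clock_at iterS -/(clock_at B N n).
case: (clock_at B N n) => t x y /= [sE /andP[xt tx] /andP[yt ty]].
case: ifPn => [txS|]; first by split; [lia|rewrite txS mulSn; lia|rewrite yt].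
rewrite -ltnNge => ltx; case: ifPn => [tyS|].
  split; [lia|by rewrite xt|rewrite tyS /=].
  by apply: leq_trans ty _; rewrite leq_mul2l leqnSn orbT.
rewrite -ltnNge => lty; split; [lia|by rewrite ltx leqW|].
apply/andP; split; first by apply: leq_trans yt _; rewrite leq_exp2r.
have tN : (t < N)%N by lia.
move: lty; rewrite !mulnS -!mulnn; nia.
Qed.

Lemma clock_at_monotone (B N a b : nat) : (a <= b)%N ->
  [/\ (ticks (clock_at B N a) <= ticks (clock_at B N b))%N
    & (blocks (clock_at B N a) <= blocks (clock_at B N b))%N].
Proof.
have mono f : (forall s, f s <= f (clock_step B N s))%N ->
    {homo (fun n => f (clock_at B N n)) : i j / (i <= j)%N}.
  move=> fS; apply: homo_leq => [//|? ? ?|i]; first exact: leq_trans.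
  by rewrite /clock_at iterS.
move=> ab; split; [apply: (mono ticks)|apply: (mono blocks)] => // -[t x y] /=;
  by do 2?[case: ifP => //].
Qed.

(** Closing a block leaves the first [d] coordinates unchanged: the full
    displacement [P B - P 0] passes from the running copy of [P] to the
    completed ones. *)
Definition blocked_path (d B N : nat) (P : nat -> 'rV[int]_d) (n : nat) :
    'rV[int]_(d + (1 + 1)) :=
  let: Clock t x y := clock_at B N n in
  row_mx (x%:Z *: (P B - P 0%N) + P (t - x * B)%N)
    (row_mx x%:Z%:M y%:Z%:M).

Lemma blocked_path_standard (d B N : nat) (P : nat -> 'rV[int]_d) :
  (0 < N)%N -> standard_basis_path B P ->
  standard_basis_path N (blocked_path d B N P).
Proof.
move=> N0 stdP n nN; rewrite /blocked_path.
have := clock_at_spec B N n N0 (ltnW nN).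
have := clock_at_spec B N n.+1 N0 nN.
rewrite /clock_at iterS -/(clock_at B N n).
case: (clock_at B N n) => t x y /=.
have dE (u v : 'rV[int]_d) (a b a' b' : int) :
    row_mx u (row_mx a%:M b%:M) - row_mx v (row_mx a'%:M b'%:M)
    = row_mx (u - v) (row_mx (a - a')%:M (b - b')%:M).
  by rewrite opp_row_mx add_row_mx opp_row_mx add_row_mx !raddfB.
have m1 : 1%:M = delta_mx 0 0 :> 'M[int]_1.
  by apply/matrixP => i j; rewrite !ord1 !mxE.
case: ifPn => [txS|].
  move=> [_ /andP[h1 _] _] [_ /andP[_ h2] _].
  have tE : t = (x.+1 * B)%N by apply/eqP; rewrite eqn_leq h2 h1.
  exists (rshift d (lshift 1 (0 : 'I_1))).
  rewrite delta_mx_rshift delta_mx_lshift dE subrr -m1 tE subnn mulSn addnK.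
  congr (row_mx _ (row_mx _ _)); last by rewrite raddf0.
    by apply/rowP => i; rewrite intS !mxE; ring.
  by rewrite intS addrK.
rewrite -ltnNge => ltx; case: ifPn => tyS _ [_ /andP[xt _] _].
  exists (rshift d (rshift 1 (0 : 'I_1))).
  rewrite !delta_mx_rshift dE !subrr -m1 raddf0.
  by rewrite intS addrK.
have tB : (t - x * B < B)%N by move: ltx; rewrite mulSn; lia.
have [i Pi] := stdP _ tB; exists (lshift (1 + 1) i).
rewrite delta_mx_lshift dE !subrr !raddf0 row_mx0 subSn//.
by rewrite -Pi opprD addrACA subrr add0r.
Qed.

Lemma blocked_path_noncollinear (d B N : nat) (P : nat -> 'rV[int]_d) :
  (16 * N <= B ^ 2)%N -> noncollinear_upto d B P ->
  noncollinear_upto (d + (1 + 1)) N (blocked_path d B N P).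
Proof.
move=> BN ncP a b c /andP[ab bc] cN.
have bN := leq_trans (ltnW bc) cN; have aN := leq_trans (ltnW ab) bN.
have N0 : (0 < N)%N by lia.
have [tab xab] := clock_at_monotone B N a b (ltnW ab).
have [tbc xbc] := clock_at_monotone B N b c (ltnW bc).
move: (clock_at_spec B N a N0 aN) (clock_at_spec B N b N0 bN)
  (clock_at_spec B N c N0 cN).
rewrite /blocked_path; move: tab xab tbc xbc.
case: (clock_at B N a) => t1 x1 y1; case: (clock_at B N b) => t2 x2 y2.
case: (clock_at B N c) => t3 x3 y3 /= t12 x12 t23 x23.
move=> [e1 /andP[xl1 xu1] /andP[yl1 yu1]].
move=> [e2 /andP[xl2 xu2] /andP[yl2 yu2]].
move=> [e3 /andP[xl3 xu3] /andP[yl3 yu3]].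
rewrite !opp_row_mx !add_row_mx !scale_row_mx => /eq_row_mx[EQ].
move=> /eq_row_mx[/rowP/(_ 0) Ex /rowP/(_ 0) Ey].
move: Ex Ey; rewrite !mxE /= !mulr1n => Ex Ey.
set al := c%:Z - a%:Z in EQ Ex Ey; set be := b%:Z - a%:Z in EQ Ex Ey.
have be0 : 0 < be by lia.
have beal : be < al by lia.
(* The index of a vertex is t + x + y, so t inherits the proportion. *)
have Et : al * (t2%:Z - t1%:Z) = be * (t3%:Z - t1%:Z).
  have -> : t2%:Z - t1%:Z = be - (x2%:Z - x1%:Z) - (y2%:Z - y1%:Z) by lia.
  have -> : t3%:Z - t1%:Z = al - (x3%:Z - x1%:Z) - (y3%:Z - y1%:Z) by lia.
  by rewrite 2!mulrBr Ex Ey; ring.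
have [x13|x13] := ltnP x1 x3.
  have g12 : B%:Z <= 2 * (t2%:Z - t1%:Z).
    apply: (block_gaps _ al be _ _ t3%:Z x1 x2 x3) => //; lia.
  have g23 : B%:Z <= 2 * (t3%:Z - t2%:Z).
    (* Reverse the path; the shift by 1 exchanges the two block bounds. *)
    have -> : t3%:Z - t2%:Z = - t2%:Z - - t3%:Z by lia.
    apply: (block_gaps _ al (al - be) _ _ (- t1%:Z)
      (- x3%:Z - 1) (- x2%:Z - 1) (- x1%:Z - 1)); lia.
  have gap : (t2%:Z - t1%:Z) * (t3%:Z - t2%:Z) < 4 * N%:Z.
    apply: (parabola_gaps _ al be _ _ _ y1 y2 y3) => //; lia.
  have : B%:Z * B%:Z <= (2 * (t2%:Z - t1%:Z)) * (2 * (t3%:Z - t2%:Z)).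
    by apply: ler_pM.
  lia.
(* All three vertices lie in the same block from here on. *)
have {x12 x13 x23} [? ?] : x2 = x1 /\ x3 = x1 by lia.
subst x2 x3.
(* Two equal values of t force the third; then the values of y are distinct,
   since those of t + x + y are, while the bounds on y admit only two. *)
have dt13 : t2 = t1 \/ t2 = t3 -> t3 = t1.
  move=> t2E; apply/eqP; rewrite -eqz_nat -subr_eq0.
  case: t2E Et => ->.
    by rewrite subrr mulr0 => /esym/eqP; rewrite mulf_eq0 (gt_eqF be0).
  by move/eqP; rewrite -subr_eq0 -mulrBl mulf_eq0 (subr_eq0 al) (gt_eqF beal).
have t13 : t3 != t1.
  apply/eqP => ?; subst t3.
  have ? : t2 = t1 by lia.
  subst t2.
  suff : (2 * N * y1.+2 <= 2 * N * y3)%N by lia.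
  rewrite leq_mul2l; lia.
have t12n : (t1 < t2)%N.
  rewrite ltn_neqAle t12 andbT; apply: contra_neq t13 => ?; apply: dt13; lia.
have t23n : (t2 < t3)%N.
  rewrite ltn_neqAle t23 andbT; apply: contra_neq t13 => ?; apply: dt13; lia.
apply: (ncP (t1 - x1 * B) (t2 - x1 * B) (t3 - x1 * B))%N; [lia|lia|].
have cancelE (u v w : 'rV[int]_d) : u + v - (u + w) = v - w.
  by rewrite opprD addrACA subrr add0r.
rewrite !cancelE in EQ.
have -> : (t3 - x1 * B)%N%:Z - (t1 - x1 * B)%N%:Z = t3%:Z - t1%:Z by lia.
have -> : (t2 - x1 * B)%N%:Z - (t1 - x1 * B)%N%:Z = t2%:Z - t1%:Z by lia.
apply/rowP => i; move/rowP/(_ i): EQ; rewrite !mxE => EQ.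
apply: (@mulfI _ be); first by rewrite gt_eqF.
by rewrite mulrA -Et mulrAC EQ; ring.
Qed.

(** * Doubly exponential length *)

(** Using each letter once: between the vertices b < c the coordinate of index b
    increases, whereas it vanishes up to b. *)
Lemma row_staircase (d : nat) : exists P : nat -> 'rV[int]_d,
  standard_basis_path d P /\ noncollinear_upto d d P.
Proof.
exists (fun t => \row_i (i < t)%N%:Z); split=> [t td|a b c /andP[ab bc] cd].
  exists (Ordinal td); apply/rowP => i.
  rewrite !mxE eqxx /= -val_eqE /= ltnS leq_eqVlt.
  by case: ltngtP.
move=> /rowP/(_ (Ordinal (leq_trans bc cd))); rewrite !mxE /=; lia.
Qed.

Lemma noncollinear_path_square (d B N : nat) : (16 * N <= B ^ 2)%N ->
  (exists P : nat -> 'rV[int]_d,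
    standard_basis_path B P /\ noncollinear_upto d B P) ->
  exists P : nat -> 'rV[int]_d.+2,
    standard_basis_path N P /\ noncollinear_upto d.+2 N P.
Proof.
move=> BN [P [stdP ncP]]; have -> : d.+2 = (d + (1 + 1))%N by rewrite addn2.
have [->|N0] := posnP N; first by exists (fun _ => 0); split => // a b c; lia.
exists (blocked_path d B N P); split; first exact: blocked_path_standard.
exact: blocked_path_noncollinear.
Qed.

(** The factor 16 makes the recursion exact:
    16 * (16 * M ^ 2) = (16 * M) ^ 2.  The base case, with 32 distinct letters,
    holds in every dimension from 32 on, and so provides a start for both
    parities of [d]. *)
Lemma doubly_exponential_path (k d : nat) : (32 + k.*2 <= d)%N ->
  exists P : nat -> 'rV[int]_d,
    standard_basis_path (16 * 2 ^ (2 ^ k)) P /\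
    noncollinear_upto d (16 * 2 ^ (2 ^ k)) P.
Proof.
elim: k d => [|k IHk] d dk.
  have [P [stdP ncP]] := row_staircase d.
  exists P; split=> [t t32|a b c abc c32]; first by apply: stdP; lia.
  by apply: ncP => //; lia.
case: d dk => [|[|d]] dk; try lia.
apply: (noncollinear_path_square _ _ _ _ (IHk d _)); last by lia.
by rewrite expnMn -expnM muln2 -mul2n -expnS mulnA.
Qed.

Lemma max_length_ge (R : realType) (k d : nat) : (32 + k.*2 <= d)%N ->
  (((2 ^ 2 ^ k)%N%:R : R)%:E <= max_length R d)%E.
Proof.
move=> /doubly_exponential_path[P [stdP ncP]].
apply: (@le_trans _ _ ((16 * 2 ^ 2 ^ k)%N%:R : R)%:E).
  by rewrite lee_fin ler_nat leq_pmull.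
apply: ereal_sup_ubound; exists (16 * 2 ^ 2 ^ k)%N => //; exists P; split=> //.
exact: noncollinear_uptoP.
Qed.

Lemma ln2_pos (R : realType) : 0 < ln (2 : R).
Proof. by rewrite ln_gt0// ltr1n. Qed.

Lemma log2e_pow2 (R : realType) (n : nat) :
  log2e (((2 ^ n)%N%:R : R)%:E) = n%:R%:E.
Proof.
rewrite /log2e natrX lne_EFin ?exprn_gt0// lnXn//.
by rewrite -EFinM -[ln 2 *+ n]mulr_natl mulfK// gt_eqF// ln2_pos.
Qed.

Lemma le_log2e (R : realType) (x y : \bar R) :
  (0 <= x)%E -> (x <= y)%E -> (log2e x <= log2e y)%E.
Proof.
move=> x0 xy; apply: lee_wpmul2r.
  by rewrite lee_fin invr_ge0 ltW// ln2_pos.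
by rewrite lee_lne// in_itv /= leey andbT ?x0// (le_trans x0).
Qed.

Theorem theorem1p1 (R : realType) :
  exists C0 : R, 0 < C0 /\
    exists d0 : nat, forall d : nat, (d0 <= d)%N ->
      ((2 / 5 * d%:R - C0)%:E <= log2e (log2e (max_length R d)))%E.
Proof.
(* k >= (d - 33) / 2 >= (2 / 5) * d - 17. *)
exists 17; split=> //; exists 32%N => d d32.
pose k := ((d - 32)./2)%N.
apply: (@le_trans _ _ (k%:R%:E)).
  have : (d <= k.*2 + 33)%N by rewrite /k; lia.
  rewrite -(ler_nat R) natrD -muln2 natrM lee_fin.
  have : 0 <= d%:R :> R by []. lra.
rewrite -log2e_pow2; apply: le_log2e; first by rewrite lee_fin.
rewrite -log2e_pow2; apply: le_log2e; first by rewrite lee_fin.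
by apply: max_length_ge; rewrite /k; lia.
Qed.
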